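(* Let $G$ be a connected graph of treedepth $k$. Then: (1) $G$ is $\frac1k$-flexibly $k$-choosable; (2) more generally, for every list assignment $L$ on $G$ with $|L(v)|=k$ for all $v\in V(G)$, every uniquely weighted request on $G$ with list assignment $L$ is $\frac1k$-satisfiable; (3) $G$ is weighted $\frac{1}{k^2}$-flexibly $k$-choosable.
   Context: Graphs are finite and simple. The height of a rooted tree $T$ is the number of vertices in a longest path from the root to a leaf. The closure of a rooted tree $T$ is the graph on $V(T)$ in which each vertex is adjacent to all of its ancestors and all of its descendants in $T$. The treedepth of $G$ is the minimum height of a rooted tree $T$ such that $G$ is a subgraph of the closure of $T$. A list assignment $L$ on $G$ assigns to each vertex $v$ a set $L(v)$ of colors. An $L$-coloring is a proper coloring $\varphi$ of $G$ with $\varphi(v)\in L(v)$ for every $v$. A request on $G$ with list assignment $L$ is a function $r$ with $\operatorname{dom}(r)\subseteq V(G)$ and $r(v)\in L(v)$ for all $v\in\operatorname{dom}(r)$. For $\varepsilon>0$, $r$ is $\varepsilon$-satisfiable if there is an $L$-coloring $\varphi$ with $\varphi(v)=r(v)$ for at least $\varepsilon|\operatorname{dom}(r)|$ vertices $v\in\operatorname{dom}(r)$. A weighted request is a function $w$ assigning a non-negative real number $w(v,c)$ to each pair $(v,c)$ with $v\in V(G)$, $c\in L(v)$. It is uniquely weighted if for each $v$ at most one color $c\in L(v)$ has $w(v,c)\ne 0$. A weighted request is $\varepsilon$-satisfiable if there is an $L$-coloring $\varphi$ with $\sum_{v\in V(G)} w(v,\varphi(v))\ge \varepsilon\sum_{v\in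 V(G),\,c\in L(v)} w(v,c)$. $G$ is $\varepsilon$-flexibly $k$-choosable (respectively weighted $\varepsilon$-flexibly $k$-choosable) if for every list assignment $L$ with $|L(v)|=k$ for all $v$, every request (respectively every weighted request) on $G$ is $\varepsilon$-satisfiable. *)

(* Defs.v *)
From HB Require Import structures.
From mathcomp Require Import all_boot all_order all_algebra.
From mathcomp Require Import finmap reals.

Set Implicit Arguments.
Unset Strict Implicit.
Unset Printing Implicit Defensive.

Import Order.TTheory GRing.Theory Num.Theory.
Local Open Scope ring_scope.

Record sgraph := SGraph {
  vertex :> finType;
  edge : rel vertex;
  edge_sym : symmetric edge;
  edge_irrefl : irreflexive edge }.

(* The graph with no vertices counts as connected here. *)
Definition connected_graph (G : sgraph) : Prop :=
  forall x y : G, connect (@edge G) x y.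

(* A rooted tree given by its parent map; the root is its own parent, and
   iterating the parent map from any node reaches the root. *)
Record rtree := RTree {
  node :> finType;
  root : node;
  parent : node -> node;
  parent_root : parent root = root;
  root_reachable : forall x : node, fconnect parent x root }.

(* Reflexive: every node is an ancestor of itself. *)
Definition ancestor (T : rtree) (a x : T) : bool := fconnect (@parent T) x a.

Definition leaf (T : rtree) (x : T) : bool :=
  [forall y : T, (y != root T) ==> (parent y != x)].

(* The vertices of the path from the root to x are the ancestors of x. *)
Definition height (T : rtree) : nat :=
  (\max_(x : T | leaf x) #|[set a : T | ancestor a x]|)%N.

Definition closure_edge (T : rtree) (x y : T) : bool :=
  (x != y) && (ancestor x y || ancestor y x).

(* T may have more nodes than G; "subgraph" is taken up to renaming of
   vertices. *)
Definition subgraph_of_closure (G : sgraph) (T : rtree) : Prop :=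
  exists2 f : G -> T, injective f &
    forall x y : G, edge x y -> closure_edge (f x) (f y).

Definition has_treedepth (G : sgraph) (k : nat) : Prop :=
  (exists2 T : rtree, subgraph_of_closure G T & height T = k) /\
  (forall T : rtree, subgraph_of_closure G T -> (k <= height T)%N).

Definition list_assignment (G : sgraph) (C : choiceType) := G -> {fset C}.

Definition list_size (G : sgraph) (C : choiceType) (L : list_assignment G C)
    (k : nat) : Prop :=
  forall v : G, #|` L v| = k.

Definition list_coloring (G : sgraph) (C : choiceType)
    (L : list_assignment G C) (phi : G -> C) : Prop :=
  (forall v : G, phi v \in L v) /\
  (forall u v : G, edge u v -> phi u <> phi v).

(* A partial function on the vertices: r v = None means v \notin dom r. *)
Definition request (G : sgraph) (C : choiceType) (L : list_assignment G C)
    (r : G -> option C) : Prop :=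
  forall (v : G) (c : C), r v = Some c -> c \in L v.

Definition request_dom (G : sgraph) (C : choiceType) (r : G -> option C) :
    {set G} :=
  [set v : G | r v != None].

Definition satisfiable (R : realType) (G : sgraph) (C : choiceType)
    (L : list_assignment G C) (eps : R) (r : G -> option C) : Prop :=
  exists2 phi : G -> C, list_coloring L phi &
    eps * #|request_dom r|%:R
      <= #|[set v in request_dom r | Some (phi v) == r v]|%:R.

(* Only the values w v c with c \in L v are meaningful; the others are
   unconstrained and never used. *)
Definition weighted_request (R : realType) (G : sgraph) (C : choiceType)
    (L : list_assignment G C) (w : G -> C -> R) : Prop :=
  forall (v : G) (c : C), c \in L v -> 0 <= w v c.

Definition uniquely_weighted (R : realType) (G : sgraph) (C : choiceType)
    (L : list_assignment G C) (w : G -> C -> R) : Prop :=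
  forall (v : G) (c d : C), c \in L v -> d \in L v ->
    w v c != 0 -> w v d != 0 -> c = d.

Definition weighted_satisfiable (R : realType) (G : sgraph) (C : choiceType)
    (L : list_assignment G C) (eps : R) (w : G -> C -> R) : Prop :=
  exists2 phi : G -> C, list_coloring L phi &
    eps * (\sum_(v : G) \sum_(c <- L v) w v c) <= \sum_(v : G) w v (phi v).

Definition flexibly_choosable (R : realType) (eps : R) (k : nat)
    (G : sgraph) : Prop :=
  forall (C : choiceType) (L : list_assignment G C), list_size L k ->
  forall r : G -> option C, request L r -> satisfiable L eps r.

Definition weighted_flexibly_choosable (R : realType) (eps : R) (k : nat)
    (G : sgraph) : Prop :=
  forall (C : choiceType) (L : list_assignment G C), list_size L k ->
  forall w : G -> C -> R, weighted_request L w -> weighted_satisfiable L eps w.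

(* Main.v *)
(* Fix for each vertex v one requested color r v. By induction on h, a rooted
   forest of height at most h with lists of size at least h has an L-coloring
   that satisfies a 1/h fraction of the weight of the requests: components are
   treated separately, and in a tree with root u one tries h colors of L(u),
   among them r u if possible, deleting the color used at u from the other lists.
   A request r v below u survives at least h - 1 of the h trials, and in each of
   them a 1/(h-1) fraction of the surviving weight is satisfied, so v contributes
   on average w(v)/h; so does u. A uniquely weighted request is of this form, and
   a general one becomes so by keeping only the heaviest color of each list, which
   costs another factor 1/k. *)
Require Import Defs.
From mathcomp Require Import all_boot all_order all_algebra.
From mathcomp Require Import finmap reals.

Set Implicit Arguments.
Unset Strict Implicit.
Unset Printing Implicit Defensive.

Import Order.TTheory GRing.Theory Num.Theory.
Local Open Scope ring_scope.

(** Averaging: if every term fell short, [size s] times the sum over the nonempty [s] would be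
    strictly below [size s] times [q]. *)
Lemma ler_sum_exists (R : realDomainType) (I : eqType) (s : seq I)
    (F : I -> R) (q : R) : (0 < size s)%N ->
  q <= \sum_(i <- s) F i -> exists2 i, i \in s & q <= (size s)%:R * F i.
Proof.
move=> s_gt0 le_q; apply/hasP/negPn/negP; rewrite -all_predC => /allP Hs.
suff : \sum_(i <- s) (size s)%:R * F i < \sum_(i <- s) q.
  rewrite -mulr_sumr big_const_seq count_predT iter_addr_0 -[ltRHS]mulr_natl.
  by apply/negP; rewrite -leNgt ler_wpM2l ?ler0n.
have ltF i : i \in s -> (size s)%:R * F i < q.
  by move=> /Hs /=; rewrite ltNge.
case: s s_gt0 {le_q Hs} ltF => // a s _; set n := size _ => ltF.
rewrite !big_cons ltr_leD ?ltF ?mem_head // big_seq [leRHS]big_seq.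
by apply: ler_sum => i i_s; rewrite ltW // ltF // inE i_s orbT.
Qed.

(** * Weighted colorings of forests *)

Section Forest.

Variables (R : realFieldType) (V : finType) (C : choiceType).
Variables (adj anc : rel V) (w : V -> R).
Hypothesis anc_refl : reflexive anc.
Hypothesis anc_trans : transitive anc.
Hypothesis anc_anti : antisymmetric anc.
Hypothesis anc_chain :
  forall x a b, anc a x -> anc b x -> anc a b || anc b a.
Hypothesis adj_irr : irreflexive adj.
Hypothesis adj_anc : forall x y, adj x y -> anc x y || anc y x.
Hypothesis w_ge0 : forall v, 0 <= w v.

Definition coloring_on (S : {set V}) (L : V -> {fset C}) (phi : V -> C) :=
  {in S, forall v, phi v \in L v} /\
  {in S &, forall u v, adj u v -> phi u != phi v}.

(** A forest is a vertex set with the ancestor order restricted to it, so deleting vertices needs no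
    rebuilding of a parent map. *)
Definition height_le (S : {set V}) (h : nat) :=
  {in S, forall v, #|[set a in S | anc a v]| <= h}%N.

Lemma height_leW (S S' : {set V}) h :
  S' \subset S -> height_le S h -> height_le S' h.
Proof.
move=> sub hS v vS'; apply: leq_trans (hS v (subsetP sub v vS')).
apply/subset_leq_card/subsetP => a; rewrite !inE => /andP[aS' ->].
by rewrite (subsetP sub).
Qed.

(** Take a vertex with fewest ancestors in [S]: a proper ancestor would have fewer still. *)
Lemma forest_root (S : {set V}) : S != set0 ->
  exists2 u, u \in S & forall a, a \in S -> anc a u -> a = u.
Proof.
case/set0Pn=> x xS.
pose d v := #|[set a in S | anc a v]|.
case: (arg_minnP d xS) => u uS u_min; have {}uS : u \in S := uS.
exists u => // a aS a_u.
apply/eqP/negPn/negP => a_neq.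
have /leq_trans/(_ (u_min a aS)) : (d a < d u)%N; last by rewrite ltnn.
apply/proper_card/properP; split.
  apply/subsetP => b; rewrite !inE => /andP[-> /anc_trans]; exact.
exists u; rewrite !inE ?uS ?anc_refl //=.
by apply/negP => u_a; rewrite (@anc_anti a u) ?a_u ?eqxx in a_neq.
Qed.

(** Deleting colors may destroy requests, so only those still in the lists count. The induction is
    on a bound [n] for the size of [S], since splitting off a component does not lower [h]. *)
Lemma forest_coloring n (S : {set V}) h (L : V -> {fset C}) (r : V -> C) :
  (#|S| <= n)%N -> height_le S h -> {in S, forall v, h <= #|` L v|}%N ->
  exists2 phi, coloring_on S L phi &
    h%:R^-1 * (\sum_(v in S) w v *+ (r v \in L v))
      <= \sum_(v in S) w v *+ (r v == phi v).
Proof.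
elim: n => [|n IHn] in S h L *.
  rewrite leqn0 cards_eq0 => /eqP-> _ _.
  by exists r; [split=> [v|? ?]; rewrite inE | rewrite !big_set0 mulr0].
move=> leSn hS hL; have [->|/forest_root[u uS u_root]] := eqVneq S set0.
  by exists r; [split=> [v|? ?]; rewrite inE | rewrite !big_set0 mulr0].
have h_gt0 : (0 < h)%N.
  by apply: leq_trans (hS u uS); apply/card_gt0P; exists u; rewrite inE uS /=.
pose U := [set v in S | anc u v].
have subU : U \subset S by apply/subsetP => v /[!inE] /andP[].
have uU : u \in U by rewrite inE uS /=.
have [eqU|neqU] := eqVneq U S; last first.
  have [|||phi1 [col1 adj1] sat1] := IHn U h L.
  - by rewrite -ltnS (leq_trans _ leSn) // proper_card // properEneq neqU.
  - exact: height_leW hS.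
  - by move=> v /(subsetP subU)/hL.
  have [|||phi2 [col2 adj2] sat2] := IHn (S :\: U) h L.
  - rewrite -ltnS (leq_trans _ leSn) // proper_card // properE subsetDl /=.
    by apply/subsetPn; exists u; rewrite ?inE ?uS ?anc_refl.
  - exact: height_leW (subsetDl _ _) hS.
  - by move=> v /setDP[/hL].
  (* An ancestor [y] of [x] is comparable with [u], and [u] has no proper ancestor in [S], so [y]
     would lie in [U]. *)
  have noadj x y : x \in U -> y \in S -> y \notin U -> ~~ (anc x y || anc y x).
    rewrite !inE => /andP[xS u_x] yS; rewrite yS /= => Nu_y.
    rewrite negb_or (contra _ Nu_y) => [|/(anc_trans u_x)//] /=.
    apply: contra Nu_y => y_x.
    by case/orP: (anc_chain u_x y_x) => // y_u; rewrite (u_root y).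
  pose phi v := if v \in U then phi1 v else phi2 v.
  exists phi.
    split=> [v vS | x y xS yS xy].
      rewrite /phi; case: ifPn => [/col1//|vU]; apply: col2.
      by apply/setDP.
    rewrite /phi; case: ifPn => xU; case: ifPn => yU.
    - exact: adj1.
    - by have := noadj _ _ xU yS yU; rewrite adj_anc.
    - by have := noadj _ _ yU xS xU; rewrite orbC adj_anc.
    - by apply: adj2 => //; apply/setDP.
  rewrite !(big_setID (A := S) U) /= (setIidPr subU) mulrDr lerD //.
    by apply: le_trans sat1 _; under [leRHS]eq_bigr => v vU do rewrite /phi vU.
  apply: le_trans sat2 _; rewrite le_eqVlt; apply/orP; left; apply/eqP.
  by apply: eq_bigr => v /setDP[_ /negPf vU]; rewrite /phi vU.
have u_anc v : v \in S -> anc u v by rewrite -eqU inE => /andP[].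
(* Hence for [h = 1] the default inverse of 0 in [F] below only multiplies an empty sum. *)
have h_gt1 v : v \in S :\ u -> (1 < h)%N.
  move=> /setD1P[v_u vS]; apply: leq_trans (hS v vS).
  have <- : #|[set u; v]| = 2%N by rewrite cards2 eq_sym v_u.
  apply/subset_leq_card/subsetP => a /[!inE] /orP[] /eqP->; rewrite ?uS ?vS /=.
    exact: u_anc.
  exact: anc_refl.
(* The rotation puts [r u], if it is in the list, first, so that truncation keeps it. *)
pose s := take h (rot (index (r u) (L u)) (L u)).
have size_s : size s = h by rewrite size_takel // size_rot hL.
have uniq_s : uniq s by rewrite take_uniq // rot_uniq fset_uniq.
have sub_s c : c \in s -> c \in L u by move=> /mem_take; rewrite mem_rot.
have ru_s : r u \in L u -> r u \in s.
  by move=> ru; rewrite /s rot_index // -(prednK h_gt0) /= mem_head.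
(* The weight guaranteed when [u] gets color [c]: its own, if requested, plus the inductive share of
   what survives below. *)
pose F c := w u *+ (r u == c) +
  h.-1%:R^-1 * \sum_(v in S :\ u) w v *+ (r v \in (L v `\ c)%fset).
have [||c c_s Fc] := @ler_sum_exists _ _ s F (\sum_(v in S) w v *+ (r v \in L v)).
- by rewrite size_s.
- rewrite (big_setD1 u) //= big_split /= lerD //.
    case: (boolP (r u \in L u)) => [/ru_s ru|_] /=; last first.
      by apply: sumr_ge0 => c _; rewrite mulrn_wge0.
    rewrite (bigD1_seq (r u)) //= eqxx ler_wpDr //.
    by apply: sumr_ge0 => c _; rewrite mulrn_wge0.
  rewrite -mulr_sumr exchange_big /= mulr_sumr; apply: ler_sum => v vS.
  rewrite ler_pdivlMl ?ltr0n -1?ltnS ?prednK ?(h_gt1 v) //.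
  under eq_bigr => c _ do rewrite in_fsetD1 andbC -mulnb mulrnA.
  rewrite sumrMnr mulr_natl ler_wpMn2l ?mulrn_wge0 //.
  (* As [s] has no repetitions, [r v] occurs in it at most once, and at least [h - 1] trials spare
     it. *)
  have -> : (\sum_(c <- s) (r v != c) = count (predC (pred1 (r v))) s)%N.
    by rewrite -sum1_count [RHS]big_mkcond; apply: eq_bigr => c _; rewrite eq_sym.
  rewrite -(leq_add2l (count_mem (r v) s)) count_predC size_s count_uniq_mem //.
  by rewrite -[leqRHS](prednK h_gt0) -add1n leq_add2r leq_b1.
(* Each remaining vertex loses the ancestor [u], and each list at most the color [c]: both bounds
   drop to [h - 1]. *)
have [|||phi [col sat Hphi]] := IHn (S :\ u) h.-1 (fun v => L v `\ c)%fset.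
- by move: leSn; rewrite (cardsD1 u) uS.
- move=> v vS; have /setD1P[_ vS0] := vS.
  rewrite -ltnS (prednK h_gt0); apply: leq_trans (hS v vS0).
  apply/proper_card/properP; split.
    by apply/subsetP => a /[!inE] /andP[/andP[_ ->]].
  by exists u; rewrite !inE ?eqxx ?uS ?u_anc.
- move=> v /setD1P[_ /hL]; rewrite (cardfsD1 c); case: (c \in L v) => /=.
    by rewrite add1n -{1}(prednK h_gt0).
  by rewrite add0n; apply: leq_trans; rewrite leq_pred.
pose psi v := if v == u then c else phi v.
exists psi.
  split=> [v vS | x y xS yS xy]; rewrite /psi.
    case: eqP => [->|/eqP v_u]; first exact: sub_s.
    have /col : v \in S :\ u by apply/setD1P.
    by rewrite in_fsetD1 => /andP[].
  case: (eqVneq x u) => xu; case: (eqVneq y u) => yu.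
  - by rewrite xu yu adj_irr in xy.
  - have /col : y \in S :\ u by apply/setD1P.
    by rewrite in_fsetD1 eq_sym => /andP[].
  - have /col : x \in S :\ u by apply/setD1P.
    by rewrite in_fsetD1 => /andP[].
  - by apply: sat => //; apply/setD1P.
rewrite ler_pdivrMl ?ltr0n //; apply: le_trans Fc _; rewrite size_s.
rewrite ler_wpM2l // (big_setD1 u) //= /psi eqxx lerD2l.
apply: le_trans Hphi _; rewrite le_eqVlt; apply/orP; left; apply/eqP.
by apply: eq_bigr => v /setD1P[/negPf->].
Qed.

End Forest.

(** * The ancestor order of a rooted tree *)

Section Ancestors.

Variable T : rtree.

Lemma ancestorP (a x : T) :
  reflect (exists n, a = iter n (@parent T) x) (ancestor a x).
Proof.
by apply: (iffP idP) => [/iter_findex<-|[n ->]]; [eexists | exact: fconnect_iter].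
Qed.

Lemma ancestor_refl : reflexive (@ancestor T).
Proof. by move=> x; apply: connect0. Qed.

Lemma ancestor_trans : transitive (@ancestor T).
Proof. by move=> y x z yx zy; apply: connect_trans zy yx. Qed.

Lemma iter_parent_root n : iter n (@parent T) (Defs.root T) = Defs.root T.
Proof. by elim: n => //= n ->; exact: parent_root. Qed.

Lemma ancestor_chain (x a b : T) :
  ancestor a x -> ancestor b x -> ancestor a b || ancestor b a.
Proof.
move=> /ancestorP[m ->] /ancestorP[n ->]; case/orP: (leq_total m n) => le_mn.
  by rewrite -(subnK le_mn) iterD [X in _ || X]fconnect_iter orbT.
by rewrite -(subnK le_mn) iterD [X in X || _]fconnect_iter.
Qed.

(* A proper cycle of the parent map would never leave itself, but iterating
   the parent map long enough reaches the root, which is a fixed point. *)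
Lemma ancestor_anti : antisymmetric (@ancestor T).
Proof.
have root_cycle (x : T) m : x = iter m.+1 (@parent T) x -> x = Defs.root T.
  move=> xm; have iter_xm j : x = iter (j * m.+1) (@parent T) x.
    by elim: j => // j IHj; rewrite mulSn iterD -IHj.
  have /iter_findex xr := root_reachable x.
  set j := findex _ _ _ in xr.
  have le_j : (j <= j * m.+1)%N by rewrite leq_pmulr.
  by rewrite (iter_xm j) -(subnK le_j) iterD xr iter_parent_root.
move=> a b /andP[/ancestorP[m am] /ancestorP[n bn]].
case: m am => [//|m] am; case: n bn => [//|n] bn.
rewrite (root_cycle a (m + n.+1)%N); last by rewrite -addSn iterD -bn.
by rewrite (root_cycle b (n + m.+1)%N) // -addSn iterD -am.
Qed.

(** The height only looks at leaves, but a node with the most ancestors is a leaf: a child would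
    have all of these and itself. *)
Lemma card_ancestors_le_height (x : T) :
  (#|[set a : T | ancestor a x]| <= height T)%N.
Proof.
pose d y := #|[set a : T | ancestor a y]|.
case: (arg_maxnP d (erefl : xpredT x)) => y _ y_max.
apply: leq_trans (y_max x isT) _; apply: (leq_bigmax_cond (F := d)).
apply/forallP => z; apply/implyP => z_root; apply/negP => /eqP pz.
have /leq_trans/(_ (y_max z isT)) : (d y < d z)%N; last by rewrite ltnn.
have y_z : ancestor y z by apply/ancestorP; exists 1%N.
apply/proper_card/properP; split.
  by apply/subsetP => a /[!inE] a_y; exact: ancestor_trans y_z.
exists z; rewrite !inE ?ancestor_refl //; apply/negP => z_y.
(* Otherwise [z] is its own parent, hence the root, which was excluded. *)
have zy : z = y by apply: ancestor_anti; rewrite z_y.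
have fixz n : iter n (@parent T) z = z by elim: n => //= n ->; rewrite pz.
have /iter_findex := root_reachable z.
by rewrite fixz => zr; rewrite zr eqxx in z_root.
Qed.

End Ancestors.

Lemma height_gt0 (T : rtree) : (0 < height T)%N.
Proof.
apply: leq_trans (card_ancestors_le_height (Defs.root T)).
by apply/card_gt0P; exists (Defs.root T); rewrite inE ancestor_refl.
Qed.

(** * From forests to flexibility *)

Section Flexibility.

Variables (R : realType) (G : sgraph) (T : rtree).
Hypothesis subT : subgraph_of_closure G T.
Let k := height T.

Lemma closure_coloring (C : choiceType) (L : list_assignment G C)
    (r : G -> C) (w : G -> R) :
  list_size L k -> (forall v, 0 <= w v) -> (forall v, r v \in L v) ->
  exists2 phi, list_coloring L phi &
    k%:R^-1 * (\sum_v w v) <= \sum_v w v *+ (r v == phi v).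
Proof.
move=> Lk w0 rL; have [f f_inj f_edge] := subT.
(* Nodes of [T] outside the image of [f] disappear, so the pulled-back order may be that of a forest
   with several roots. *)
pose anc : rel G := fun x y => ancestor (f x) (f y).
have [|||||||||phi [col adj] sat] := @forest_coloring R G C (@edge G) anc w
  _ _ _ _ _ _ _ #|[set: G]| [set: G] k L r (leqnn _).
- by move=> x; exact: ancestor_refl.
- by move=> y x z; exact: ancestor_trans.
- by move=> x y /ancestor_anti/f_inj.
- by move=> x a b; exact: ancestor_chain.
- exact: edge_irrefl.
- by move=> x y /f_edge/andP[].
- exact: w0.
- move=> v _; apply: leq_trans (card_ancestors_le_height (f v)).
  rewrite -(card_imset _ f_inj); apply/subset_leq_card/subsetP => _ /imsetP[a + ->].
  by rewrite !inE.
- by move=> v _; rewrite Lk.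
exists phi; first split=> [v|u v uv]; first exact: col.
  by apply/eqP/adj.
have sumT (F : G -> R) : \sum_(v in [set: G]) F v = \sum_v F v.
  by apply: eq_bigl => v; rewrite inE.
move: sat; rewrite !sumT; apply: le_trans; rewrite ler_wpM2l ?invr_ge0 //.
by apply: ler_sum => v _; rewrite rL.
Qed.

(** Request at each vertex a color carrying a share [a] of its weight; nonnegativity lets the other
    colors be ignored. It serves with [a = 1] for unique weights and [a = 1/k] in general. *)
Lemma satisfiable_of_heavy_color (C : choiceType) (L : list_assignment G C)
    (a : R) (w : G -> C -> R) :
  list_size L k -> weighted_request L w ->
  (forall v, exists2 c, c \in L v & a * (\sum_(d <- L v) w v d) <= w v c) ->
  weighted_satisfiable L (k%:R^-1 * a) w.
Proof.
move=> Lk w0 heavy.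
pose P v c := (c \in L v) && (a * (\sum_(d <- L v) w v d) <= w v c).
have exP v : exists c, P v c by have [c cL ?] := heavy v; exists c; apply/andP.
pose r v := xchoose (exP v).
have rL v : r v \in L v by have /andP[] := xchooseP (exP v).
have [|phi col sat] := closure_coloring (w := fun v => w v (r v)) Lk _ rL.
  by move=> v; apply: w0.
exists phi => //; have [phiL _] := col.
rewrite -mulrA mulr_sumr; apply: le_trans (le_trans sat _).
  rewrite ler_wpM2l ?invr_ge0 //; apply: ler_sum => v _.
  by have /andP[] := xchooseP (exP v).
apply: ler_sum => v _; case: eqVneq => [->|_] //=; exact: w0.
Qed.

Lemma list_inhabited (C : choiceType) (L : list_assignment G C) :
  list_size L k -> forall v, exists c, c \in L v.
Proof.
move=> Lk v; apply/fset0Pn; rewrite -cardfs_gt0 Lk; exact: height_gt0.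
Qed.

Lemma uniquely_weighted_satisfiable (C : choiceType)
    (L : list_assignment G C) (w : G -> C -> R) :
  list_size L k -> weighted_request L w -> uniquely_weighted L w ->
  weighted_satisfiable L k%:R^-1 w.
Proof.
move=> Lk w0 w1; rewrite -[k%:R^-1]mulr1.
apply: satisfiable_of_heavy_color => // v.
case: (boolP (has (fun c => w v c != 0) (L v))) => [/hasP[c cL wc]|].
  exists c => //; rewrite mul1r (bigD1_seq c) ?fset_uniq //= big_seq_cond.
  rewrite big1 ?addr0 // => d /andP[dL dc]; apply/eqP; apply: contraNT dc => wd.
  by rewrite (w1 v d c).
(* If all weights at [v] vanish, any color of its nonempty list is heavy. *)
rewrite -all_predC => /allP wz; have [c cL] := list_inhabited Lk v.
exists c => //; rewrite mul1r big_seq big1 ?w0 // => d /wz.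
by move=> /negPn/eqP.
Qed.

Lemma weighted_flexible :
  weighted_flexibly_choosable ((k%:R ^+ 2)^-1 : R) k G.
Proof.
move=> C L Lk w w0; rewrite expr2 invfM.
apply: satisfiable_of_heavy_color => // v.
have k_gt0 : (0 < k)%N by exact: height_gt0.
have := @ler_sum_exists _ _ (L v) (w v) _ _ (lexx _).
rewrite (Lk v) => /(_ k_gt0)[c cL le_c]; exists c => //.
by rewrite ler_pdivrMl ?ltr0n.
Qed.

(** With 0/1 weights marking the requested pairs, the total weight is the size of the domain and the
    weight gained counts the satisfied requests. *)
Lemma flexible : flexibly_choosable (k%:R^-1 : R) k G.
Proof.
move=> C L Lk r rL; pose w v c : R := (r v == Some c)%:R.
have [|v c d _ _|phi col sat] := @uniquely_weighted_satisfiable C L w Lk.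
- by move=> v c _; rewrite /w.
- by rewrite /w !pnatr_eq0 !eqb0 !negbK => /eqP-> /eqP[].
exists phi => //.
apply: le_trans (le_trans sat _); rewrite le_eqVlt; apply/orP; left.
  apply/eqP; congr (_ * _); rewrite -sum1_card natr_sum big_mkcond /=.
  apply: eq_bigr => v _; rewrite inE /w.
  case rv: (r v) => [c|] /=; last by rewrite big1.
  rewrite (bigD1_seq c) ?fset_uniq ?rL //= eqxx big1 ?addr0 // => d dc.
  by rewrite -[_ == _]/(c == d) eq_sym (negPf dc).
apply/eqP; rewrite -[in RHS]sum1_card natr_sum [RHS]big_mkcond /=.
apply: eq_bigr => v _; rewrite !inE /w eq_sym.
by case: (r v) => [c|] //=; case: eqP.
Qed.

End Flexibility.

Theorem theorem4p2 (R : realType) (G : sgraph) (k : nat) :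
  connected_graph G -> has_treedepth G k ->
  [/\ flexibly_choosable (k%:R^-1 : R) k G,
      (forall (C : choiceType) (L : list_assignment G C), list_size L k ->
        forall w : G -> C -> R,
          weighted_request L w -> uniquely_weighted L w ->
          weighted_satisfiable L k%:R^-1 w)
    & weighted_flexibly_choosable ((k%:R ^+ 2)^-1 : R) k G].
Proof.
move=> _ [[T subT <-] _]; split; first exact: flexible.
  by move=> C L Lk w w0 w1; exact: uniquely_weighted_satisfiable.
exact: weighted_flexible.
Qed.
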